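(* Let $R$ be an integral domain and $M$ a nonzero, non-simple unital $R$-module. Then the following statements are equivalent: (i) $M$ is a pseudo simple module. (ii) $M$ satisfies the $(\ast)$-condition. (iii) $D(M)$ is a discrete space. (iv) $D(M)$ is a Hausdorff space. (v) $D(M)$ is a $T_1$-space.
   Context: For $m,n\in M$ write $m\mid n$ if $n=rm$ for some $r\in R$ (equivalently $Rn\subseteq Rm$). Put $M^{\#}=\{0\neq m\in M: Rm\neq M\}$ and define an equivalence relation on $M^{\#}$ by $m\sim n$ iff $Rm=Rn$; let $[m]$ be the class of $m$ and $\operatorname{EC}(M^{\#})=\{[m]:m\in M^{\#}\}$. For $m\in M^{\#}$ let $U_m=\{[n]\in \operatorname{EC}(M^{\#}): n\mid m\}$. The family $\{U_m\}_{m\in M^{\#}}$ is a basis of a topology on $\operatorname{EC}(M^{\#})$, called the divisor topology of $M$ and denoted $D(M)$ (also denoting the resulting space). $M$ is pseudo simple if $Rm$ is a simple module for every $m\in M^{\#}$. $M$ satisfies the $(\ast)$-condition if, for all $m_1,m_2\in M^{\#}$ with $Rm_1\neq Rm_2$ and all $x\in M$, the inclusion $Rm_1+Rm_2\subseteq Rx$ implies $Rx=M$. *)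

(* Defs.v *)
From HB Require Import structures.
From mathcomp Require Import all_boot all_order all_algebra.
From mathcomp Require Import all_classical.
From mathcomp Require Import topology separation_axioms.

Set Implicit Arguments.
Unset Strict Implicit.
Unset Printing Implicit Defensive.

Import GRing.Theory.
Local Open Scope classical_set_scope.
Local Open Scope ring_scope.

Section Modules.
Context {R : idomainType} {M : lmodType R}.
Implicit Types (m n x : M) (N L : set M).

Definition submodule N : Prop := GRing.submod_closed (mem N).

(* For a submodule N of M, regarded as a module in its own right; M itself is
   the case N = setT. *)
Definition simple_module N : Prop :=
  [/\ submodule N, N <> [set 0] &
    forall L, submodule L -> L `<=` N -> L = [set 0] \/ L = N].

Definition cyclic_submod m : set M := [set r *: m | r in [set: R]].

Definition mdvd m n : Prop := exists r : R, n = r *: m.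

Definition Msharp : set M := [set m | m <> 0 /\ cyclic_submod m <> setT].

Definition eclass m : set M :=
  [set n | Msharp n /\ cyclic_submod n = cyclic_submod m].

End Modules.

Arguments Msharp {R} M.

Definition EC (R : idomainType) (M : lmodType R) : Type :=
  set_type [set eclass m | m in Msharp M].

Definition basic_open (R : idomainType) (M : lmodType R) (m : M) :
    set (EC M) :=
  [set c | exists n, [/\ Msharp M n, val c = eclass n & mdvd n m]].

Section DivisorTopology.
Variables (R : idomainType) (M : lmodType R).

Lemma mdvd_trans (m n p : M) : mdvd m n -> mdvd n p -> mdvd m p.
Proof. by move=> [r ->] [s ->]; exists (s * r); rewrite scalerA. Qed.

Lemma mdvd_refl (m : M) : mdvd m m.
Proof. by exists 1; rewrite scale1r. Qed.

Lemma basic_open_cover : \bigcup_(m in Msharp M) basic_open m = setT.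
Proof.
rewrite -subTset => c _; have := valP c; rewrite inE => -[m Mm mc].
by exists m => //; exists m; split=> //; exact: mdvd_refl.
Qed.

Lemma basic_open_join (m n : M) (c : EC M) : Msharp M m -> Msharp M n ->
  basic_open m c -> basic_open n c ->
  exists k, [/\ Msharp M k, basic_open k c &
    basic_open k `<=` basic_open m `&` basic_open n].
Proof.
move=> _ _ [k [Mk ck km]] [l [Ml cl ln]].
have kl : mdvd k l.
  have : eclass l k by rewrite -cl ck; split.
  move=> [_ kl]; have : cyclic_submod l l by exists 1; rewrite ?scale1r.
  by rewrite -kl => -[r _ <-]; exists r.
exists k; split=> //; first by exists k; split=> //; exact: mdvd_refl.
move=> d [p [Mp dp pk]]; split; exists p; split=> //.
  exact: mdvd_trans km.
exact: mdvd_trans (mdvd_trans pk kl) ln.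
Qed.

End DivisorTopology.

Definition divisor_space (R : idomainType) (M : lmodType R) : Type := EC M.

HB.instance Definition _ (R : idomainType) (M : lmodType R) :=
  Choice.copy (divisor_space M) (set_type [set eclass m | m in Msharp M]).

(* A base must be indexed by a pointed type; the base point 0 plays no role,
   since the indices are restricted to Msharp M. *)
Definition base_index (R : idomainType) (M : lmodType R) : pointedType :=
  HB.pack_for pointedType (GRing.Lmodule.sort M) (isPointed.Build M 0).

HB.instance Definition _ (R : idomainType) (M : lmodType R) :=
  @isBaseTopological.Build (divisor_space M) (base_index M)
    (Msharp M) (@basic_open R M)
    (@basic_open_cover R M) (@basic_open_join R M).

Definition pseudo_simple (R : idomainType) (M : lmodType R) : Prop :=
  forall m : M, Msharp M m -> simple_module (cyclic_submod m).

Definition star_condition (R : idomainType) (M : lmodType R) : Prop :=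
  forall m1 m2 : M, Msharp M m1 -> Msharp M m2 ->
  cyclic_submod m1 <> cyclic_submod m2 ->
  forall x : M,
  [set u + v | u in cyclic_submod m1 & v in cyclic_submod m2]
    `<=` cyclic_submod x ->
  cyclic_submod x = setT.

Definition discrete_space (T : topologicalType) : Prop :=
  forall A : set T, open A.

(* Main.v *)
Require Import Defs.
From mathcomp Require Import all_boot all_order all_algebra.
From mathcomp Require Import all_classical.
From mathcomp Require Import topology separation_axioms.

Local Open Scope classical_set_scope.
Local Open Scope ring_scope.

(** An open set containing a class [[n]] contains the class of every divisor of
    [n]. Hence T1 forces [Rn = Rm] for each nonzero [n] in [Rm], i.e. [Rm] is
    simple; conversely the star condition forces each [U_m] to be [{[m]}]. *)

Section CyclicSubmodules.
Context {R : idomainType} {M : lmodType R}.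
Implicit Types (m n x : M) (L : set M).

Lemma cyclic_submod_refl m : cyclic_submod m m.
Proof. by exists 1 => //; rewrite GRing.scale1r. Qed.

Lemma submodule_cyclic m : submodule (cyclic_submod m).
Proof.
split; first by apply/mem_set; exists 0 => //; rewrite GRing.scale0r.
move=> a _ _ /set_mem[r _ <-] /set_mem[s _ <-]; apply/mem_set.
by exists (a * r + s) => //; rewrite GRing.scalerDl GRing.scalerA.
Qed.

Lemma submodule0 {L} : submodule L -> L 0.
Proof. by move=> [+ _] => /set_mem. Qed.

Lemma submoduleZ L (r : R) m : submodule L -> L m -> L (r *: m).
Proof.
move=> [/= /set_mem L0 Lsub] Lm; apply/set_mem.
(* [submod_closed] only gives closure under [a *: u + v], so a bare multiple is read with
   [v = 0]. *)
by rewrite -[r *: m]GRing.addr0; apply: Lsub; exact: mem_set.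
Qed.

Lemma cyclic_submod_sub {L m} : submodule L -> L m -> cyclic_submod m `<=` L.
Proof. by move=> subL Lm _ [r _ <-]; exact: submoduleZ. Qed.

Lemma mdvdE m n : mdvd m n <-> cyclic_submod m n.
Proof. by split=> [[r ->]|[r _ <-]]; exists r. Qed.

Lemma cyclic_submodS m n :
  cyclic_submod m n -> cyclic_submod n `<=` cyclic_submod m.
Proof. exact/cyclic_submod_sub/submodule_cyclic. Qed.

Lemma cyclic_submod_neq0 m : m <> 0 -> cyclic_submod m <> [set 0].
Proof. by move=> m0 Rm0; apply: m0; have := cyclic_submod_refl m; rewrite Rm0. Qed.

Lemma Msharp_sub m n : Msharp M m -> n <> 0 -> cyclic_submod m n -> Msharp M n.
Proof.
move=> [_ mT] n0 /cyclic_submodS nm; split=> // nT; apply: mT.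
by rewrite -subTset -nT.
Qed.

(** Membership in [Msharp] puts [m] in its own class; outside [Msharp] every class is empty and
    determines no submodule. *)
Lemma eclass_eq m n : Msharp M m -> eclass m = eclass n ->
  cyclic_submod m = cyclic_submod n.
Proof.
move=> Mm mn; have : eclass m m by split.
by rewrite mn => -[].
Qed.

Lemma eq_eclass m n : cyclic_submod m = cyclic_submod n -> eclass m = eclass n.
Proof. by rewrite /eclass => ->. Qed.

End CyclicSubmodules.

Section DivisorTopology.
Context {R : idomainType} {M : lmodType R}.
Implicit Types (m n : M) (c d : divisor_space M) (A : set (divisor_space M)).

(** A point is a set of vectors packed with a proof that it is the class of some element of
    [Msharp], so [Mm] has to be supplied. *)
Definition divisor_class m (Mm : Msharp M m) : divisor_space M :=
  SigSub (mem_set (ex_intro2 _ _ m Mm erefl)).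

Lemma divisor_classP c : exists m (Mm : Msharp M m), c = divisor_class m Mm.
Proof.
have /set_mem[m Mm mc] := valP c.
by exists m, Mm; apply: val_inj; rewrite /= mc.
Qed.

Lemma divisor_class_eq m n (Mm : Msharp M m) (Mn : Msharp M n) :
  divisor_class m Mm = divisor_class n Mn <-> cyclic_submod m = cyclic_submod n.
Proof.
split=> [/(congr1 val)/=|mn]; first exact: eclass_eq.
by apply: val_inj; exact: eq_eclass.
Qed.

Lemma basic_open_class m n (Mn : Msharp M n) :
  basic_open m (divisor_class n Mn) <-> mdvd n m.
Proof.
split=> [[k [Mk /= nk /mdvdE km]]|nm]; last by exists n; split.
by apply/mdvdE; rewrite (eclass_eq _ _ Mn nk).
Qed.

Lemma open_divisorP A : open A <-> forall c, A c ->
  exists m, [/\ Msharp M m, basic_open m c & basic_open m `<=` A].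
Proof.
split=> [[I sub <-] c [m Im mc]|base].
  by exists m; split=> //; [exact: sub|move=> d md; exists m].
(* [A] is the union of all basic open sets that it contains. *)
exists [set m | Msharp M m /\ basic_open m `<=` A]; first by move=> m [].
apply/seteqP; split=> [c [m [_ mA] /mA//]|c /base[m [Mm mc mA]]].
by exists m.
Qed.

(** Some [U_k] inside [A] contains [[n]], so [m] divides [n], which divides [k], and [[m]] lies in
    [U_k] too. *)
Lemma divisor_class_specialization {m n} (Mm : Msharp M m) (Mn : Msharp M n) {A} :
  mdvd m n -> open A -> A (divisor_class n Mn) -> A (divisor_class m Mm).
Proof.
move=> mn /open_divisorP Aop /Aop[k [_ /basic_open_class nk]]; apply.
by apply/basic_open_class; exact: mdvd_trans nk.
Qed.

End DivisorTopology.

Section Implications.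
Context {R : idomainType} {M : lmodType R}.

(** If [Rx] were proper, it would be simple, and its nonzero submodules [Rm1] and [Rm2] would both
    equal it. *)
Lemma pseudo_simple_star : pseudo_simple M -> star_condition M.
Proof.
move=> simpleM m1 m2 M1 M2 neq12 x sub12; apply: contrapT => xT.
have x1 : cyclic_submod x m1.
  apply: sub12; exists m1; first exact: cyclic_submod_refl.
  exists 0; last by rewrite GRing.addr0.
  exact/submodule0/submodule_cyclic.
have x2 : cyclic_submod x m2.
  apply: sub12; exists 0; first exact/submodule0/submodule_cyclic.
  by exists m2; [exact: cyclic_submod_refl|rewrite GRing.add0r].
have x0 : x <> 0.
  by move=> x0; case: x1 M1 => r _ <- []; rewrite x0 GRing.scaler0.
have [_ _ simplex] := simpleM x (conj x0 xT).
have eqx m : Msharp M m -> cyclic_submod x m -> cyclic_submod m = cyclic_submod x.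
  move=> [m0 _] xm.
  have [|//] := simplex _ (submodule_cyclic m) (cyclic_submodS _ _ xm).
  by move=> /(cyclic_submod_neq0 _ m0).
by apply: neq12; rewrite !eqx.
Qed.

Lemma star_discrete : star_condition M -> discrete_space (divisor_space M).
Proof.
move=> starM A; apply/open_divisorP => c Ac.
have [m [Mm cE]] := divisor_classP c; subst c.
exists m; split=> //; first by apply/basic_open_class; exact: mdvd_refl.
move=> d; have [n [Mn ->]] := divisor_classP d => /basic_open_class/mdvdE nm.
suff /(divisor_class_eq _ _ Mm Mn) <- : cyclic_submod m = cyclic_submod n by [].
apply: contrapT => mn; case: (Mn) => _; apply.
(* The condition is used with [x = n]: as [n] divides [m], the sum [Rm + Rn] lies in [Rn], which is
   proper. *)
apply: (starM m n) => // _ [u /(cyclic_submodS _ _ nm) nu [v nv <-]].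
have [_ sub] := submodule_cyclic n.
by apply/set_mem; rewrite -[u]GRing.scale1r; apply: sub; exact: mem_set.
Qed.

Lemma discrete_hausdorff (T : topologicalType) :
  discrete_space T -> hausdorff_space T.
Proof.
move=> discT p q pq; suff [x [-> ->]] : [set p] `&` [set q] !=set0 by [].
by apply: pq; apply: open_nbhs_nbhs; split=> //; exact: discT.
Qed.

Lemma accessible_pseudo_simple :
  accessible_space (divisor_space M) -> pseudo_simple M.
Proof.
move=> T1 m Mm; split.
- exact: submodule_cyclic.
- by apply: cyclic_submod_neq0; case: Mm.
(* Either [L] is zero, or it contains some nonzero [n]; then [Rn = Rm] will force [L = Rm]. *)
move=> L subL Lm; have [L0|/nonsubset[n [Ln n0]]] := pselect (L `<=` [set 0]).
  by left; apply/seteqP; split=> // _ ->; exact: submodule0.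
right; apply/seteqP; split=> //.
have mn : cyclic_submod m n by exact: Lm.
have Mn : Msharp M n by exact: Msharp_sub mn.
suff <- : cyclic_submod n = cyclic_submod m by exact: cyclic_submod_sub.
apply/(divisor_class_eq _ _ Mn Mm)/eqP; apply: contrapT => /negP.
(* If the classes differed, T1 would give an open set containing [[n]] but not [[m]], although [m]
   divides [n]. *)
move=> /T1[A [Aop /set_mem An /set_mem]]; apply.
exact: divisor_class_specialization ((mdvdE _ _).2 mn) Aop An.
Qed.

End Implications.

Theorem theorem17 (R : idomainType) (M : lmodType R)
    (M_nonzero : exists m : M, m <> 0)
    (M_nonsimple : ~ simple_module [set: M]) :
  [<-> pseudo_simple M;
       star_condition M;
       discrete_space (divisor_space M);
       hausdorff_space (divisor_space M);
       accessible_space (divisor_space M)].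
Proof.
tfae.
- exact: pseudo_simple_star.
- exact: star_discrete.
- exact: discrete_hausdorff.
- exact: hausdorff_accessible.
- exact: accessible_pseudo_simple.
Qed.
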